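(* As formal power series in $x$, $$\sum_{n\ge 0}|\mathcal{M}_n(P_1,P_2,P_3,P_4,P_5)|\,x^n=\frac{1-2x+2x^2+x^3}{(1-x)^3}.$$
   Context: A matching with $n$ arcs is a partition of $\{1,2,\ldots,2n\}$ into blocks of size 2, called arcs; an arc is written $[a,b]$ with $a<b$, where $a$ is its opener and $b$ its closer. For $n=0$ there is exactly one (empty) matching. A matching is Stoimenow if it contains no pair of arcs $[i,\ell],[i+1,k]$ with $i+1<k<\ell$ (Type 1) and no pair of arcs $[k,j+1],[\ell,j]$ with $k<\ell<j$ (Type 2). A matching $M$ contains a pattern (a matching) $P$ with $m$ arcs if some $m$ arcs of $M$ become $P$ after their $2m$ endpoints are relabelled $1,\ldots,2m$ in the order-preserving way; otherwise $M$ avoids $P$. $\mathcal{M}_n(Q_1,\ldots,Q_r)$ denotes the set of Stoimenow matchings with $n$ arcs avoiding every one of $Q_1,\ldots,Q_r$. The patterns are $P_1=\{[1,3],[2,7],[4,5],[6,8]\}$, $P_2=\{[1,3],[2,5],[4,7],[6,8]\}$, $P_3=\{[1,2],[3,5],[4,6],[7,8]\}$, $P_4=\{[1,2],[3,5],[4,7],[6,8]\}$, $P_5=\{[1,3],[2,5],[4,6],[7,8]\}$. *)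

(* Defs.v *)
From mathcomp Require Import all_boot all_order all_algebra.

Set Implicit Arguments.
Unset Strict Implicit.
Unset Printing Implicit Defensive.

Import GRing.Theory.

(* The points 1, ..., 2n are represented by the ordinals 0, ..., 2n-1 of      *)
(* 'I_(n.*2): the ordinal i stands for the point i.+1.                        *)
Definition is_matching (n : nat) (M : {set {set 'I_(n.*2)}}) : bool :=
  partition M [set: 'I_(n.*2)] && [forall A in M, #|A| == 2].

Definition is_arc (n : nat) (M : {set {set 'I_(n.*2)}}) (a b : 'I_(n.*2)) :
    bool :=
  (a < b) && ([set a; b] \in M).

Definition has_type1 (n : nat) (M : {set {set 'I_(n.*2)}}) : bool :=
  [exists i : 'I_(n.*2), exists i' : 'I_(n.*2),
   exists k : 'I_(n.*2), exists l : 'I_(n.*2),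
    [&& i' == i.+1 :> nat, is_arc M i l, is_arc M i' k, i' < k & k < l]].

Definition has_type2 (n : nat) (M : {set {set 'I_(n.*2)}}) : bool :=
  [exists j : 'I_(n.*2), exists j' : 'I_(n.*2),
   exists k : 'I_(n.*2), exists l : 'I_(n.*2),
    [&& j' == j.+1 :> nat, is_arc M k j', is_arc M l j, k < l & l < j]].

Definition stoimenow (n : nat) (M : {set {set 'I_(n.*2)}}) : bool :=
  [&& is_matching M, ~~ has_type1 M & ~~ has_type2 M].

(* f lists the endpoints of the arcs of A increasingly, so that relabelling   *)
(* the endpoint f i as i is the order-preserving relabelling of A.            *)
Definition relabels (m n : nat) (f : {ffun 'I_(m.*2) -> 'I_(n.*2)})
    (A : {set {set 'I_(n.*2)}}) (P : {set {set 'I_(m.*2)}}) : bool :=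
  [&& [forall i : 'I_(m.*2), forall j : 'I_(m.*2), (i < j) ==> (f i < f j)],
      f @: [set: 'I_(m.*2)] == cover A
    & [set f @: (arc : {set 'I_(m.*2)}) | arc in P] == A].

Definition contains (m n : nat) (M : {set {set 'I_(n.*2)}})
    (P : {set {set 'I_(m.*2)}}) : bool :=
  [exists A : {set {set 'I_(n.*2)}}, exists f : {ffun 'I_(m.*2) -> 'I_(n.*2)},
    [&& A \subset M, #|A| == m & relabels f A P]].

Definition stoimenow_avoiders (m n : nat) (Qs : seq {set {set 'I_(m.*2)}}) :
    {set {set {set 'I_(n.*2)}}} :=
  [set M | stoimenow M && all (fun Q => ~~ contains M Q) Qs].

(* Here the pairs in s are written with the labels 1, ..., 2m.                *)
Definition arcs_of (m : nat) (s : seq (nat * nat)) : {set {set 'I_(m.*2)}} :=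
  [set A | has (fun ab => A == [set i : 'I_(m.*2) | i.+1 \in [:: ab.1; ab.2]]) s].

Definition P1 := arcs_of 4 [:: (1, 3); (2, 7); (4, 5); (6, 8)].
Definition P2 := arcs_of 4 [:: (1, 3); (2, 5); (4, 7); (6, 8)].
Definition P3 := arcs_of 4 [:: (1, 2); (3, 5); (4, 6); (7, 8)].
Definition P4 := arcs_of 4 [:: (1, 2); (3, 5); (4, 7); (6, 8)].
Definition P5 := arcs_of 4 [:: (1, 3); (2, 5); (4, 6); (7, 8)].

Local Open Scope ring_scope.

Definition fps (K : fieldType) : Type := nat -> K.

Definition fps_of_poly (K : fieldType) (p : {poly K}) : fps K := fun n => p`_n.

Definition fps_mul (K : fieldType) (a b : fps K) : fps K :=
  fun n => \sum_(i < n.+1) a i * b (n - i)%N.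

Fixpoint fps_inv_coefs (K : fieldType) (a : fps K) (n : nat) : seq K :=
  if n is k.+1 then
    let s := fps_inv_coefs a k in
    rcons s (((k == 0%N)%:R - \sum_(i < k) s`_i * a (k - i)%N) / a 0%N)
  else [::].

(* The inverse of a when a 0 != 0 (see fps_mulVf), a junk value otherwise.    *)
Definition fps_inv (K : fieldType) (a : fps K) : fps K :=
  fun n => (fps_inv_coefs a n.+1)`_n.

Definition fps_div (K : fieldType) (a b : fps K) : fps K :=
  fps_mul a (fps_inv b).

Lemma size_fps_inv_coefs (K : fieldType) (a : fps K) n :
  size (fps_inv_coefs a n) = n.
Proof. by elim: n => //= n IHn; rewrite size_rcons IHn. Qed.

Lemma nth_fps_inv_coefs (K : fieldType) (a : fps K) n i :
  (i < n)%N -> (fps_inv_coefs a n)`_i = fps_inv a i.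
Proof.
elim: n => // n IHn; rewrite ltnS leq_eqVlt => /predU1P[-> //|lt_in].
by rewrite /= nth_rcons size_fps_inv_coefs lt_in IHn.
Qed.

Lemma fps_mulVf (K : fieldType) (a : fps K) :
  a 0%N != 0 -> fps_mul (fps_inv a) a =1 fps_of_poly 1.
Proof.
move=> a0 n; rewrite /fps_mul /fps_of_poly coef1 big_ord_recr /= subnn.
rewrite {2}/fps_inv /= nth_rcons size_fps_inv_coefs ltnn eqxx divfK //.
under [X in _ - X]eq_bigr => i _ do rewrite nth_fps_inv_coefs //.
by rewrite addrC subrK.
Qed.

Lemma patterns_are_matchings :
  all (fun P : {set {set 'I_(4.*2)}} => is_matching P) [:: P1; P2; P3; P4; P5].
Proof.
have arcsP (s : seq (nat * nat)) :
    all (fun ab => \sum_(i < 8) (i.+1 \in [:: ab.1; ab.2]) == 2)%N s ->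
    all (fun i : nat => has (fun ab => i.+1 \in [:: ab.1; ab.2]) s) (iota 0 8) ->
    (forall ab cd, ab \in s -> cd \in s ->
       has (fun x => x \in [:: ab.1; ab.2]) [:: cd.1; cd.2] -> ab = cd) ->
  is_matching (arcs_of 4 s).
- move=> card2 coverT triv.
  have card_arc A : A \in arcs_of 4 s -> #|A| = 2%N.
    rewrite inE => /hasP[ab /(allP card2)/eqP sum2 /eqP->].
    by rewrite cardsE -sum1_card big_mkcond -[RHS]sum2; apply: eq_bigr.
  rewrite /is_matching; apply/andP; split; last first.
    by apply/forall_inP => A /card_arc->.
  apply/and3P; split.
  + rewrite eqEsubset subsetT; apply/subsetP => i _.
    have /(allP coverT)/hasP[ab ab_s i_ab] : val i \in iota 0 8.
      by rewrite mem_iota /= ltn_ord.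
    apply/bigcupP; exists [set j : 'I_(4.*2) | j.+1 \in [:: ab.1; ab.2]].
      by rewrite inE; apply/hasP; exists ab.
    by rewrite inE.
  + apply/trivIsetP => A B; rewrite !inE.
    move=> /hasP[ab ab_s /eqP->] /hasP[cd cd_s /eqP->]; apply: contraR.
    move=> /pred0Pn[i /andP[/=]]; rewrite [in X in X -> _]inE => i_ab.
    rewrite [in X in X -> _]inE => i_cd.
    by rewrite (triv ab cd) //; apply/hasP; exists i.+1.
  + by apply/negP => /card_arc; rewrite cards0.
have triv_seq (s : seq (nat * nat)) :
    all (fun ab => all (fun cd =>
      has (fun x => x \in [:: ab.1; ab.2]) [:: cd.1; cd.2] ==> (ab == cd)) s) s ->
  forall ab cd, ab \in s -> cd \in s ->
    has (fun x => x \in [:: ab.1; ab.2]) [:: cd.1; cd.2] -> ab = cd.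
- move=> /allP h ab cd /h/allP h1 /h1/implyP h2 meet.
  exact/eqP/h2.
by rewrite /= !arcsP //=; do ?[exact: triv_seq | rewrite !big_ord_recl !big_ord0].
Qed.

(* Main.v *)
Require Import Defs.
From mathcomp Require Import all_boot all_order all_algebra.
From mathcomp Require Import zify ring.

Set Implicit Arguments.
Unset Strict Implicit.
Unset Printing Implicit Defensive.

Import GRing.Theory.

(** The avoiders have a rigid shape, which makes them easy to count.

    A Stoimenow matching with a nested pair of arcs contains P1. Let [a,b] be
    the outer arc and [c,d] the inner one. In a run of consecutive openers a
    Stoimenow matching has increasing closers, so the positions from a to c are
    not all openers; the first closer after a belongs to an arc opened before a
    (nested_left). By symmetry the last opener before b belongs to an arc closed
    after b, and these four arcs form P1. Conversely a nonnesting matching is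
    Stoimenow and avoids P1, which has a nested pair. So only nonnesting
    matchings matter from there on.

    A nonnesting matching has openers o 0 < o 1 < ... and closers
    c 0 < c 1 < ..., the k-th arc being [o k, c k] (nonnesting_present); it is
    determined by the relation o k < c j, because o k is k plus the number of
    closers below it, and similarly for c j (rank_formula).

    Among arcs i < j < k < l, each of P2, P3, P4, P5 says that
    c i < o k < c j < o l, and the four of them list the possible relative
    positions of o j, c i and of o l, c k. So avoiding all four means that there
    is no such chain. Let p be the last k with o k < c 0 and q the last j with
    c j < o (n-1). A chain with i = 0 and l = n-1 arises as soon as
    o k < c j for some k > p and j <= q with j < k; in its absence
    o k < c j holds exactly when k <= p or j > q or k <= j. The matching is thus
    determined by (p, q), and every pair with p, q < n-1 occurs. The only other
    case is that all openers precede all closers. This gives (n-1)^2 + 1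
    avoiders for n >= 1 and a single one for n = 0
    (card_stoimenow_avoiders).

    On the side of power series, the inverse of (1 - x)^3 has the binomial
    coefficients C(n+2, 2) as coefficients, and multiplying by the cubic
    numerator gives the same numbers. *)

(** * Nested arcs in a Stoimenow matching *)

(** A relation r on positions abstracts the arcs of a matching, r_step being
    the exclusion of the first forbidden configuration. Exchanging the two ends
    of the line turns the second configuration into the first, so that the
    lemmas below also serve for the mirror image. *)
Section Runs.
Variables (N : nat) (r : rel 'I_N).
Hypothesis r_lt : forall x y, r x y -> x < y.
Hypothesis r_total : forall x, exists y, r x y || r y x.
Hypothesis r_fun : forall x y z, r x y -> r x z -> y = z.
Hypothesis r_step : forall i i' l k : 'I_N,
  i' = i.+1 :> nat -> r i l -> r i' k -> l <= k.

Lemma run_le (a b c d : 'I_N) : r a b -> r c d -> a <= c ->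
  (forall x : 'I_N, a <= x <= c -> [exists y, r x y]) -> b <= d.
Proof.
move=> rab; have [m lecm] := ubnP (c : nat).
elim: m => // m IHm in c d lecm *; move=> rcd leac run.
have [eqac|ltac] := eqVneq a c; first by rewrite -eqac in rcd; rewrite (r_fun rab rcd).
have {ltac leac} ltac : a < c by rewrite ltn_neqAle leac andbT.
have lt_c : c.-1 < N by have := ltn_ord c; lia.
have /existsP[d' rd'] : [exists y, r (Ordinal lt_c) y] by apply: run => /=; lia.
have le_dd' : d' <= d by apply: r_step rd' rcd => /=; lia.
apply: leq_trans le_dd'; apply: IHm rd' _ _ => /=; try lia.
by move=> x lex; apply: run; lia.
Qed.

(** The first closer p after a lies before c, as otherwise a, ..., c would be a
    run of openers and b <= d. Its opener cannot be a or come after a, as then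
    b <= p by the same argument. *)
Lemma nested_left (a b c d : 'I_N) : r a b -> r c d -> a < c -> d < b ->
  exists o p : 'I_N, [/\ r o p, o < a, a < p & p < c].
Proof.
move=> rab rcd ltac ltdb.
pose P (x : 'I_N) := (a <= x <= c) && ~~ [exists y, r x y].
have [x0 Px0] : exists x0, P x0.
  apply/existsP; apply: contraLR ltdb => /existsPn noP.
  rewrite -leqNgt; apply: run_le rab rcd (ltnW ltac) _ => x lex.
  by have := noP x; rewrite /P lex negbK.
case: (arg_minnP (fun x : 'I_N => val x) Px0) => p /andP[/andP[leap lepc] noy] minp.
have [o] := r_total p; case/orP=> [rp|rop].
  by case/existsP: noy; exists o.
have ltop := r_lt rop; have ltcd := r_lt rcd.
have neap : val a != val p.
  by apply: contraNneq noy => /val_inj <-; apply/existsP; exists b.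
have necp : val c != val p.
  by apply: contraNneq noy => /val_inj <-; apply/existsP; exists d.
exists o, p; split; rewrite ?[a < p]ltn_neqAle ?[p < c]ltn_neqAle ?neap 1?eq_sym ?necp //.
rewrite ltnNge; apply/negP => leao.
have : b <= p; last by lia.
apply: run_le rab rop leao _ => x lex; apply: contraT => nox.
have : p <= x by apply: minp; rewrite /P nox andbT; move: lex ltop lepc; clear; lia.
by lia.
Qed.
End Runs.

(** * Arcs and pattern containment *)

Section Matchings.
Variable n : nat.
Implicit Types (M : {set {set 'I_(n.*2)}}) (a b c d x y : 'I_(n.*2)).

Lemma is_arc_lt M a b : is_arc M a b -> a < b.
Proof. by case/andP. Qed.

Lemma is_arc_total M x : is_matching M -> exists y, is_arc M x y || is_arc M y x.
Proof.
case/andP=> /and3P[/eqP cov _ _] /forall_inP card2.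
have : x \in cover M by rewrite cov inE.
case/bigcupP=> A AM xA.
have /cards2P := card2 _ AM; case=> a [b [neq_ab defA]].
have neqv : (a : nat) != b by [].
have arc_ab : is_arc M a b || is_arc M b a.
  rewrite /is_arc [[set b; a]]setUC -defA AM !andbT; lia.
move: xA; rewrite defA => /set2P[] ->; first by exists b; rewrite arc_ab.
by exists a; rewrite orbC.
Qed.

Lemma is_arc_meet M a b c d : is_matching M -> is_arc M a b -> is_arc M c d ->
  (a \in [set c; d]) || (b \in [set c; d]) -> a = c /\ b = d.
Proof.
case/andP=> /and3P[_ /trivIsetP triv _] _ /andP[ltab abM] /andP[ltcd cdM] meet.
have eq_arcs : [set a; b] = [set c; d].
  apply/eqP/negPn/negP => neq.
  have := triv _ _ abM cdM neq; rewrite -setI_eq0 => /eqP/setP disj.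
  case/orP: meet => [aI|bI]; first by have := disj a; rewrite in_setI in_set0 aI set21.
  by have := disj b; rewrite in_setI in_set0 bI set22.
have : a \in [set c; d] by rewrite -eq_arcs !inE eqxx.
have : b \in [set c; d] by rewrite -eq_arcs !inE eqxx orbT.
have : c \in [set a; b] by rewrite eq_arcs !inE eqxx.
have : d \in [set a; b] by rewrite eq_arcs !inE eqxx orbT.
rewrite !inE -!val_eqE /= => h1 h2 h3 h4.
by split; apply: val_inj => /=; lia.
Qed.

Definition nonnesting M := forall a b c d,
  is_arc M a b -> is_arc M c d -> a < c -> b < d.

Lemma card_matching M : is_matching M -> #|M| = n.
Proof.
case/andP=> part /forall_inP card2.
have := card_uniform_partition (fun A AM => eqP (card2 A AM)) part.
by rewrite cardsT card_ord => h; lia.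
Qed.
End Matchings.

(** The arcs witnessing a containment are the images of those of P under the
    relabelling. Their number and their endpoints are right because P, being a
    matching, has m arcs covering all the labels. *)
Lemma containsP m n (M : {set {set 'I_(n.*2)}}) (P : {set {set 'I_(m.*2)}}) :
  is_matching P ->
  reflect (exists2 f : 'I_(m.*2) -> 'I_(n.*2), {homo f : i j / i < j} &
             forall A, A \in P -> f @: A \in M)
          (contains M P).
Proof.
move=> matchP; apply: (iffP existsP) => [[A /existsP[f]]|[f incf fP]].
  case/and3P=> AM _ /and3P[/forallP incf _ /eqP defA].
  exists f => [i j ltij|B BP].
    by have /forallP/(_ j)/implyP := incf i; apply.
  by apply: (subsetP AM); rewrite -defA imset_f.
have injf : injective f.
  move=> i j eqf; apply: val_inj => /=.
  case: (ltngtP i j) => // /incf; rewrite eqf ltnn //.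
pose g := [ffun i => f i].
have gE (B : {set 'I_(m.*2)}) : g @: B = f @: B.
  by apply: eq_imset => i; rewrite ffunE.
exists [set f @: (B : {set _}) | B in P]; apply/existsP; exists g; apply/and3P; split.
- by apply/subsetP=> _ /imsetP[B BP ->]; apply: fP.
- by rewrite card_imset ?card_matching //; apply: imset_inj.
apply/and3P; split.
- by apply/forallP=> i; apply/forallP=> j; apply/implyP=> /incf; rewrite !ffunE.
- case/andP: matchP => /and3P[/eqP covP _ _] _.
  by rewrite gE -covP imset_cover cover_imset.
- by apply/eqP; apply: eq_imset => B; rewrite gE.
Qed.

(** Functions on nat, of which only the values below 8 matter, avoid carrying
    bounds in the many concrete positions used later. *)
Lemma contains_arcsP n (M : {set {set 'I_(n.*2)}}) (s : seq (nat * nat)) :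
  is_matching (arcs_of 4 s) ->
  all (fun ab => [&& 0 < ab.1, ab.1 < ab.2 & ab.2 <= 8]) s ->
  reflect (exists2 g : nat -> 'I_(n.*2), (forall i j, i < j < 8 -> g i < g j) &
             all (fun ab => is_arc M (g ab.1.-1) (g ab.2.-1)) s)
          (contains M (arcs_of 4 s)).
Proof.
move=> matchs /allP in_range.
have range (ab : nat * nat) : ab \in s -> [&& 0 < ab.1, ab.1 < ab.2 & ab.2 <= 8].
  exact: in_range.
have setE (g : nat -> 'I_(n.*2)) (ab : nat * nat) : ab \in s ->
    [set g i | i : 'I_8 in [set i : 'I_8 | i.+1 \in [:: ab.1; ab.2]]] =
    [set g ab.1.-1; g ab.2.-1].
  move=> /range /and3P[gt0 lt12 lt28].
  have lt1 : ab.1.-1 < 8 by lia.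
  have lt2 : ab.2.-1 < 8 by lia.
  rewrite -[g _.1.-1]/((fun i : 'I_8 => g i) (Ordinal lt1)).
  rewrite -[g _.2.-1]/((fun i : 'I_8 => g i) (Ordinal lt2)).
  rewrite -2!(imset_set1 (fun i : 'I_8 => g i)) -imsetU.
  apply: (congr1 (fun B : {set 'I_8} => (fun i : 'I_8 => g i) @: B)).
  by apply/setP=> i; rewrite !inE -!(inj_eq val_inj) /=; lia.
apply: (iffP (containsP _ matchs)) => [[f incf fP]|[g incg /allP gs]].
  exists (fun i => f (inord i)) => [i j ltij|].
    by apply: incf; rewrite !inordK //; lia.
  apply/allP=> ab abs; have /and3P[gt0 lt12 lt28] := range _ abs.
  rewrite /is_arc -(setE (fun i => f (inord i))) //; apply/andP; split.
    by apply: incf; rewrite !inordK; lia.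
  under eq_imset => i do rewrite inord_val.
  by apply: fP; rewrite inE; apply/hasP; exists ab.
exists (fun i => g i) => [i j ltij|A]; first by apply: incg; rewrite ltij ltn_ord.
rewrite inE => /hasP[ab abs /eqP->].
by rewrite setE //; have /andP[] := gs _ abs.
Qed.

Lemma contains_of_seq n (M : {set {set 'I_(n.*2)}}) s x0 (t : seq 'I_(n.*2)) :
  is_matching (arcs_of 4 s) ->
  all (fun ab => [&& 0 < ab.1, ab.1 < ab.2 & ab.2 <= 8]) s ->
  size t = 8 -> sorted ltn (map val t) ->
  all (fun ab => is_arc M (nth x0 t ab.1.-1) (nth x0 t ab.2.-1)) s ->
  contains M (arcs_of 4 s).
Proof.
move=> matchs range size_t sorted_t arcs; apply/contains_arcsP => //.
exists (nth x0 t) => // i j /andP[ltij ltj8].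
have lti8 := ltn_trans ltij ltj8.
rewrite -!(nth_map x0 (val x0) val) ?size_t //.
by apply: (sorted_ltn_nth ltn_trans _ sorted_t); rewrite ?inE ?size_map ?size_t.
Qed.

(** * Nonnesting matchings as pairs of increasing sequences *)

Lemma card_initial m i : i <= m -> #|[set x : 'I_m | x < i]| = i.
Proof.
move=> leim; rewrite -sum1_card (eq_bigl (fun x : 'I_m => x < i)).
  by rewrite -(big_ord_widen _ (fun=> 1)) // sum1_card card_ord.
by move=> x; rewrite inE.
Qed.

Section Presentations.
Variable n : nat.
Implicit Types (M : {set {set 'I_(n.*2)}}) (o c : 'I_n -> 'I_(n.*2)).

Definition mk_matching o c : {set {set 'I_(n.*2)}} :=
  [set [set o k; c k] | k : 'I_n].

Definition separated o c :=
  [/\ {homo o : i j / i < j}, {homo c : i j / i < j},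
      forall k, o k < c k & forall i j, o i != c j].

Lemma incr_ltE o : {homo o : i j / i < j} -> forall i j, (o i < o j) = (i < j).
Proof.
move=> inc i j; have [/inc//|/inc|/val_inj->] := ltngtP i j; last by rewrite !ltnn.
by move=> lt; apply/negbTE; rewrite -leqNgt ltnW.
Qed.

Lemma incr_inj o : {homo o : i j / i < j} -> injective o.
Proof.
move=> inc i j eqo; apply: val_inj; have := incr_ltE inc i j.
by have := incr_ltE inc j i; rewrite eqo ltnn /=; lia.
Qed.

Lemma separated_cover o c : separated o c ->
  o @: [set: 'I_n] :|: c @: [set: 'I_n] = setT.
Proof.
move=> [inco incc _ neq]; apply/eqP; rewrite eqEcard subsetT /= cardsU.
rewrite !(card_imset _ (incr_inj _)) // !cardsT !card_ord.
rewrite (_ : _ :&: _ = set0) ?cards0; first by lia.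
apply/setP=> x; rewrite !inE; apply/negP=> /andP[/imsetP[i _ ->] /imsetP[j _]].
by apply/eqP.
Qed.

Lemma mk_matchingP o c a b : separated o c ->
  reflect (exists2 k, a = o k & b = c k) (is_arc (mk_matching o c) a b).
Proof.
move=> [_ _ ltoc neq]; apply: (iffP andP) => [[ltab /imsetP[k _ eq_arc]]|[k -> ->]].
  have : a \in [set o k; c k] by rewrite -eq_arc set21.
  have : b \in [set o k; c k] by rewrite -eq_arc set22.
  have := ltoc k.
  by move=> lt /set2P[] eqb /set2P[] eqa; subst; first [by exists k|move: ltab lt; lia].
by split=> //; apply: imset_f.
Qed.

Lemma mk_matching_matching o c : separated o c -> is_matching (mk_matching o c).
Proof.
move=> sep; have [inco incc ltoc neq] := sep.
apply/andP; split; last first.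
  by apply/forall_inP=> _ /imsetP[k _ ->]; rewrite cards2 neq.
apply/and3P; split.
- rewrite eqEsubset subsetT -(separated_cover sep) /=.
  apply/subsetP=> x; rewrite inE => /orP[] /imsetP[k _ ->].
    by apply/bigcupP; exists [set o k; c k]; [apply: imset_f | rewrite set21].
  by apply/bigcupP; exists [set o k; c k]; [apply: imset_f | rewrite set22].
- apply/trivIsetP=> _ _ /imsetP[i _ ->] /imsetP[j _ ->] neq_arcs.
  have neqij : i != j by apply: contraNneq neq_arcs => ->.
  rewrite -setI_eq0; apply/eqP/setP=> x; rewrite in_setI in_set0.
  apply/negP=> /andP[/set2P[]-> /set2P[]/eqP].
  + by rewrite (inj_eq (incr_inj inco)) (negbTE neqij).
  + by rewrite (negbTE (neq _ _)).
  + by rewrite eq_sym (negbTE (neq _ _)).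
  + by rewrite (inj_eq (incr_inj incc)) (negbTE neqij).
- by apply/imsetP=> [[k _ /setP/(_ (o k))]]; rewrite set21 inE.
Qed.

Lemma mk_matching_nonnesting o c : separated o c -> nonnesting (mk_matching o c).
Proof.
move=> sep a b x y /(mk_matchingP _ _ sep)[i -> ->] /(mk_matchingP _ _ sep)[j -> ->].
by have [inco incc _ _] := sep; rewrite !incr_ltE.
Qed.

(** Below f k lie exactly the values f i with i < k and some values of g. It
    recovers both sequences of a matching from their relative order. *)
Lemma rank_formula (f g : 'I_n -> 'I_(n.*2)) k :
  {homo f : i j / i < j} -> injective g -> (forall i j, f i != g j) ->
  f @: [set: 'I_n] :|: g @: [set: 'I_n] = setT ->
  f k = k + #|[set j | g j < f k]| :> nat.
Proof.
move=> incf injg neq cov.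
have {1}<- := card_initial (ltnW (ltn_ord (f k))).
have <- := card_initial (ltnW (ltn_ord k)).
rewrite -(card_imset _ (incr_inj incf)) -(card_imset [set j | g j < f k] injg).
rewrite -cardsUI (_ : _ :&: _ = set0) ?cards0 ?addn0.
  apply: eq_card => x; rewrite !inE.
  have : x \in [set: 'I_(n.*2)] by []; rewrite -cov inE => /orP[] /imsetP[i _ ->].
    rewrite incr_ltE // mem_imset ?inE; last exact: incr_inj.
    by rewrite orbC; case: imsetP => // [[j _]] /eqP; rewrite (negbTE (neq _ _)).
  rewrite orbC mem_imset // inE; case: imsetP; rewrite ?orbF //.
  by case=> j _ /eqP; rewrite eq_sym (negbTE (neq _ _)).
apply/setP=> x; rewrite !inE; apply/negP=> /andP[/imsetP[i _ ->] /imsetP[j _ /eqP]].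
by rewrite (negbTE (neq _ _)).
Qed.

Lemma separated_ext o c o' c' : separated o c -> separated o' c' ->
  (forall k j, (o k < c j) = (o' k < c' j)) -> o =1 o' /\ c =1 c'.
Proof.
move=> sep sep' rel; have [inco incc _ neq] := sep; have [inco' incc' _ neq'] := sep'.
have gtE (u v : 'I_n -> 'I_(n.*2)) : (forall i j, u i != v j) ->
    forall i j, (v j < u i) = ~~ (u i < v j).
  move=> ne i j; rewrite -leqNgt ltn_neqAle andb_idl // => _.
  by rewrite (inj_eq val_inj) eq_sym ne.
split=> k; apply: val_inj => /=.
  rewrite (rank_formula k inco (incr_inj incc) neq (separated_cover sep)).
  rewrite (rank_formula k inco' (incr_inj incc') neq' (separated_cover sep')).
  by congr addn; apply: eq_card => j; rewrite !inE (gtE _ _ neq) (gtE _ _ neq') rel.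
have neqC i j : c i != o j by rewrite eq_sym.
have neqC' i j : c' i != o' j by rewrite eq_sym.
have cov := separated_cover sep; have cov' := separated_cover sep'; rewrite setUC in cov.
rewrite setUC in cov'.
rewrite (rank_formula k incc (incr_inj inco) neqC) //.
rewrite (rank_formula k incc' (incr_inj inco') neqC') //.
by congr addn; apply: eq_card => j; rewrite !inE rel.
Qed.

(** Since o' lists the larger set, its k-th value is the smaller one. *)
Lemma incr_image_le o o' : {homo o : i j / i < j} -> {homo o' : i j / i < j} ->
  (forall k, exists k', o k = o' k') -> forall k, o' k <= o k.
Proof.
move=> inco inco' im k.
have [k' eqk] := im k; suff lekk' : k <= k'.
  by rewrite eqk leqNgt incr_ltE // -leqNgt.
have [m ltkm] := ubnP (k : nat).
elim: m => // m IHm in k ltkm k' eqk *.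
case: (posnP k) => [-> //|k_gt0].
have lt_k1 : k.-1 < n by have := ltn_ord k; lia.
have [k1' eqk1] := im (Ordinal lt_k1).
have le_k1 : k.-1 <= k1' by apply: (IHm (Ordinal lt_k1)) => //=; lia.
have : k1' < k'; last by lia.
by rewrite -(incr_ltE inco') -eqk -eqk1 incr_ltE //=; lia.
Qed.

Lemma mk_matching_inj o c o' c' : separated o c -> separated o' c' ->
  mk_matching o c = mk_matching o' c' -> o =1 o' /\ c =1 c'.
Proof.
move=> sep sep' eqM; have [inco incc _ _] := sep; have [inco' incc' _ _] := sep'.
have arcs k : exists k', o k = o' k' /\ c k = c' k'.
  have : is_arc (mk_matching o c) (o k) (c k) by apply/mk_matchingP => //; exists k.
  by rewrite eqM => /(mk_matchingP _ _ sep')[k' -> ->]; exists k'.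
have arcs' k : exists k', o' k = o k' /\ c' k = c k'.
  have : is_arc (mk_matching o' c') (o' k) (c' k) by apply/mk_matchingP => //; exists k.
  by rewrite -eqM => /(mk_matchingP _ _ sep)[k' -> ->]; exists k'.
split=> k; apply/val_inj/anti_leq/andP; split; apply: incr_image_le => // i.
- by have [j [-> _]] := arcs' i; exists j.
- by have [j [-> _]] := arcs i; exists j.
- by have [j [_ ->]] := arcs' i; exists j.
- by have [j [_ ->]] := arcs i; exists j.
Qed.

(** The openers are enumerated increasingly; their partners then increase too,
    which is what the absence of nestings means. *)
Lemma nonnesting_present M : is_matching M -> nonnesting M ->
  exists o c, separated o c /\ M = mk_matching o c.
Proof.
move=> matchM nnM.
pose O := [set x | [exists y, is_arc M x y]].
pose p x := odflt x [pick y | is_arc M x y].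
have arc_p x : x \in O -> is_arc M x (p x).
  rewrite inE /p => /existsP[y arc_xy]; case: pickP => [//|/(_ y)].
  by rewrite arc_xy.
have defM : M = [set [set x; p x] | x in O].
  apply/setP=> A; apply/idP/imsetP=> [AM|[x /arc_p/andP[_ xM] -> //]].
  have /andP[/and3P[_ _ _] /forall_inP/(_ A AM)/cards2P] := matchM.
  case=> a [b [neq_ab defA]].
  wlog lt_ab : a b neq_ab defA / a < b => [wlog_ab|].
    have : (a : nat) != b by []; case: ltngtP => // [ltab|ltba] _.
      exact: (wlog_ab a b).
    by apply: (wlog_ab b a); rewrite // 1?eq_sym // setUC.
  have arc_ab : is_arc M a b by rewrite /is_arc lt_ab -defA.
  have aO : a \in O by rewrite inE; apply/existsP; exists b.
  exists a => //; rewrite defA.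
  by have [//|_ <-] := is_arc_meet matchM arc_ab (arc_p _ aO); rewrite ?set21.
have cardO : #|O| = n.
  rewrite -[RHS](card_matching matchM) defM card_in_imset // => x y xO yO /= eq_arcs.
  have [//|-> //] := is_arc_meet matchM (arc_p _ xO) (arc_p _ yO).
  by rewrite -eq_arcs set21.
pose o (k : 'I_n) : 'I_(n.*2) := enum_val (cast_ord (esym cardO) k).
have oO k : o k \in O by apply: enum_valP.
have sortedO : sorted (relpre val ltn) (enum O).
  rewrite {1}/enum_mem; apply: sorted_filter; first by move=> x y z /=; apply: ltn_trans.
  by rewrite -sorted_map -enumT val_enum_ord iota_ltn_sorted.
have inco : {homo o : i j / i < j}.
  move=> i j ltij; rewrite /o !(enum_val_nth (o i)).
  apply: (sorted_ltn_nth _ _ sortedO); rewrite ?inE -?cardE ?cardO ?ltn_ord //=.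
  by move=> x y z /=; apply: ltn_trans.
exists o, (fun k => p (o k)); split.
  split=> // [i j ltij|k|i j] /=.
  - by apply: nnM (arc_p _ (oO i)) (arc_p _ (oO j)) _; apply: inco.
  - exact: is_arc_lt (arc_p _ (oO k)).
  apply/eqP => eq_ij; have arc_i := arc_p _ (oO i); have arc_j := arc_p _ (oO j).
  have [|eq_o _] := is_arc_meet matchM arc_i arc_j; first by rewrite eq_ij set22.
  by have := is_arc_lt arc_j; rewrite -eq_ij eq_o ltnn.
rewrite {1}defM; apply/setP=> A; apply/imsetP/imsetP=> [[x xO ->]|[k _ ->]]; last first.
  by exists (o k).
exists (cast_ord cardO (enum_rank_in xO x)) => //=.
by rewrite /o cast_ordK enum_rankK_in.
Qed.
End Presentations.

(** * Staircase relations and the matchings they determine *)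

Section Staircases.
Variable n : nat.
Implicit Type R : rel 'I_n.

Lemma rank_bound (k : 'I_n) (A : {set 'I_n}) : k + #|A| < n.*2.
Proof.
by have := max_card A; rewrite card_ord; have := ltn_ord k; lia.
Qed.

(** The positions that rank_formula forces when the k-th opener is to precede
    the j-th closer exactly for R k j. *)
Definition opener_of R k : 'I_(n.*2) := Ordinal (rank_bound k [set j | ~~ R k j]).
Definition closer_of R k : 'I_(n.*2) := Ordinal (rank_bound k [set i | R i k]).

(** The relations o k < c j of nonnesting matchings, that is, the regions that
    Dyck paths cut out, with the diagonal inside. *)
Definition staircase R :=
  (forall k, R k k) /\
  (forall k k' j j' : 'I_n, R k j -> k' <= k -> j <= j' -> R k' j').

(** If R k j, at most j closers precede the k-th opener and at least k + 1
    openers precede the j-th closer, so that the positions are at most k + j and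
    at least k + j + 1. The next lemma is the same count with the roles of
    openers and closers exchanged. *)
Lemma staircase_lt R k j : staircase R -> R k j -> opener_of R k < closer_of R j.
Proof.
move=> [_ monoR] Rkj /=.
have le_k : k < #|[set i | R i j]|.
  rewrite -[X in X <= _](card_initial (ltn_ord k)).
  by apply/subset_leq_card/subsetP=> x; rewrite !inE => lexk; apply: monoR Rkj _ _.
have le_j : #|[set j' | ~~ R k j']| <= j.
  rewrite -[X in _ <= X](card_initial (ltnW (ltn_ord j))).
  apply/subset_leq_card/subsetP=> x; rewrite !inE; apply: contraR.
  by rewrite -leqNgt => lejx; apply: monoR Rkj _ _.
by rewrite addnC -addnS leq_add.
Qed.

Lemma staircase_gt R k j : staircase R -> ~~ R k j -> closer_of R j < opener_of R k.
Proof.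
move=> [_ monoR] nRkj /=.
have le_k : #|[set i | R i j]| <= k.
  rewrite -[X in _ <= X](card_initial (ltnW (ltn_ord k))).
  apply/subset_leq_card/subsetP=> x; rewrite !inE => Rxj; rewrite ltnNge.
  by apply: contra nRkj => lekx; apply: monoR Rxj _ _.
have le_j : j < #|[set j' | ~~ R k j']|.
  rewrite -[X in X <= _](card_initial (ltn_ord j)).
  apply/subset_leq_card/subsetP=> x; rewrite !inE => lexj.
  by apply: contra nRkj => Rkx; apply: monoR Rkx _ _.
by rewrite addnC -addnS leq_add.
Qed.

Lemma staircase_ltE R : staircase R ->
  forall k j, (opener_of R k < closer_of R j) = R k j.
Proof.
move=> stairR k j; case: (boolP (R k j)) => [/(staircase_lt stairR)//|].
by move/(staircase_gt stairR) => ltjk; apply/negbTE; rewrite -leqNgt ltnW.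
Qed.

Lemma staircase_separated R : staircase R -> separated (opener_of R) (closer_of R).
Proof.
move=> stairR; have [reflR monoR] := stairR; split.
- move=> i j ltij /=; rewrite -addSn leq_add //.
  apply/subset_leq_card/subsetP=> x; rewrite !inE; apply: contra => Rjx.
  by apply: monoR Rjx _ _ => //; apply: ltnW.
- move=> i j ltij /=; rewrite -addSn leq_add //.
  apply/subset_leq_card/subsetP=> x; rewrite !inE => Rxi.
  by apply: monoR Rxi _ _ => //; apply: ltnW.
- by move=> k; rewrite staircase_ltE.
move=> k j; rewrite -(inj_eq val_inj) neq_ltn /=.
have [/(staircase_lt stairR)/= -> //|/(staircase_gt stairR)/= ->] := boolP (R k j).
by rewrite orbT.
Qed.

(** None stands for the matching whose openers all precede its closers. For
    Some (p, q), the first p + 1 openers precede every closer, the closers after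
    the q-th follow every opener, and otherwise an opener precedes only the
    closers that it has to precede. *)
Definition two_step (t : option ('I_n.-1 * 'I_n.-1)) : rel 'I_n := fun k j =>
  if t is Some (p, q) then [|| k <= p, q < j | k <= j] else true.

Lemma two_step_staircase t : staircase (two_step t).
Proof.
split=> [k|k k' j j']; case: t => [[p q]|] //=; first by rewrite leqnn !orbT.
by lia.
Qed.

End Staircases.

(** The parameter p is read off on the first closer and q on the last opener. *)
Lemma two_step_inj n (t t' : option ('I_n.-1 * 'I_n.-1)) :
  two_step t =2 two_step t' -> t = t'.
Proof.
case: n t t' => [|[|m]] t t' eq_t; try by case: t t' {eq_t} => [[[]]|] // [[[]]|].
have no_some (p q : 'I_m.+1) : @two_step m.+2 (Some (p, q)) ord_max ord0 = false.
  by rewrite /two_step /=; have := ltn_ord p; lia.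
have pE (p q p' q' : 'I_m.+1) :
    @two_step m.+2 (Some (p, q)) =2 @two_step m.+2 (Some (p', q')) -> p <= p'.
  move=> eq2; have lt_p : p < m.+2 by apply: ltn_trans (ltn_ord p) _.
  by have := eq2 (Ordinal lt_p) ord0; rewrite /two_step /=; lia.
have qE (p q p' q' : 'I_m.+1) :
    @two_step m.+2 (Some (p, q)) =2 @two_step m.+2 (Some (p', q')) -> q' <= q.
  move=> eq2; have lt_q : q.+1 < m.+2 by rewrite ltnS.
  have := eq2 ord_max (Ordinal lt_q); rewrite /two_step /=.
  by have := ltn_ord p; have := ltn_ord q; have := ltn_ord p'; have := ltn_ord q'; lia.
case: t t' eq_t => [[p q]|] [[p' q']|] eq_t //; last 2 first.
- by have := eq_t ord_max ord0; rewrite no_some.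
- by have := eq_t ord_max ord0; rewrite no_some.
have eq_t' : @two_step m.+2 (Some (p', q')) =2 @two_step m.+2 (Some (p, q)).
  by move=> k j; rewrite eq_t.
by congr (Some (_, _)); apply/val_inj/anti_leq/andP; split; eauto.
Qed.

(** * Avoiders are the two-step matchings *)

Section Avoiders.
Variable n : nat.
Implicit Types (M : {set {set 'I_(n.*2)}}) (o c : 'I_n -> 'I_(n.*2)).

Lemma nonnesting_stoimenow M : is_matching M -> nonnesting M -> stoimenow M.
Proof.
move=> matchM nnM; apply/and3P; split=> //.
  apply/negP=> /existsP[i /existsP[i' /existsP[k /existsP[l]]]].
  move=> /and5P[/eqP eq_i arc_il arc_i'k _ ltkl].
  have ltii' : i < i' by rewrite eq_i.
  by have := nnM _ _ _ _ arc_il arc_i'k ltii'; lia.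
apply/negP=> /existsP[j /existsP[j' /existsP[k /existsP[l]]]].
move=> /and5P[/eqP eq_j arc_k arc_l ltkl _].
by have := nnM _ _ _ _ arc_k arc_l ltkl; lia.
Qed.

(** The four arcs of P1 are the given nested pair and the arcs that nested_left
    provides on each side. *)
Lemma stoimenow_nonnesting M : stoimenow M -> ~~ contains M P1 -> nonnesting M.
Proof.
case/and3P=> matchM no1 no2 noP1 a b c d arc_ab arc_cd ltac.
rewrite ltnNge; apply: contra noP1 => ledb.
have ltdb : d < b.
  rewrite ltn_neqAle ledb andbT; apply: contraTneq ltac => /val_inj eqdb.
  by have [|-> _] := is_arc_meet matchM arc_ab arc_cd; rewrite ?ltnn // eqdb set22 orbT.
have [u [p [arc_up ltua ltap ltpc]]] : exists u p, [/\ is_arc M u p, u < a, a < p & p < c].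
  apply: (nested_left (r := is_arc M)) arc_ab arc_cd ltac ltdb => //.
  - by move=> x y; apply: is_arc_lt.
  - by move=> x; apply: is_arc_total.
  - by move=> x y z xy xz; have [|] := is_arc_meet matchM xy xz; rewrite ?set21.
  move=> i i' l k eq_i arc_il arc_i'k; rewrite leqNgt; apply: contra no1 => ltkl.
  apply/existsP; exists i; apply/existsP; exists i'; apply/existsP; exists k.
  apply/existsP; exists l; apply/and5P; split=> //; first exact/eqP.
  exact: is_arc_lt arc_i'k.
(* Reading the line backwards exchanges the two excluded configurations. *)
pose r x y := is_arc M (rev_ord y) (rev_ord x).
have [e [f [arc_fe]]] : exists e f, [/\ r e f, e < rev_ord b, rev_ord b < f & f < rev_ord d].
  apply: (@nested_left _ r _ _ _ _ _ (rev_ord a) (rev_ord d) (rev_ord c)).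
  - by move=> x y /is_arc_lt /=; have := ltn_ord x; have := ltn_ord y; lia.
  - move=> x; have [y arc_xy] := is_arc_total (rev_ord x) matchM.
    by exists (rev_ord y); rewrite /r rev_ordK orbC.
  - move=> x y z yx zx; apply: rev_ord_inj.
    by have [|] := is_arc_meet matchM yx zx; rewrite ?set22 ?orbT.
  - move=> i i' l k eq_i arc_li arc_ki'; rewrite leqNgt; apply: contra no2 => ltkl.
    apply/existsP; exists (rev_ord i'); apply/existsP; exists (rev_ord i).
    apply/existsP; exists (rev_ord l); apply/existsP; exists (rev_ord k).
    have ltki' := is_arc_lt arc_ki'; have lti'N := ltn_ord i'.
    by have ltlN := ltn_ord l; apply/and5P; split=> //=; [apply/eqP | ]; lia.
  - by rewrite /r !rev_ordK.
  - by rewrite /r !rev_ordK.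
  - by rewrite /=; have := ltn_ord b; lia.
  - by rewrite /=; have := ltn_ord c; lia.
rewrite /= => lte ltf ltf'.
apply: (@contains_of_seq _ M _ a [:: u; a; p; c; d; rev_ord f; b; rev_ord e]) => //.
- by have /andP[] := patterns_are_matchings.
- rewrite /=; have := ltn_ord b; have := ltn_ord f; have := ltn_ord e.
  have := is_arc_lt arc_cd; lia.
by rewrite /= arc_up arc_ab arc_cd andbT.
Qed.

Lemma nonnesting_avoids_P1 M : nonnesting M -> ~~ contains M P1.
Proof.
move=> nnM; apply/negP=> /contains_arcsP[||g incg /and5P[_ arc_ab arc_cd _ _]] //.
  by have /andP[] := patterns_are_matchings.
by have := nnM _ _ _ _ arc_ab arc_cd (incg 1 3 isT); have := incg 4 6 isT; rewrite /=; lia.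
Qed.

(** The common part of P2, P3, P4 and P5 in terms of their arcs i < j < k < l;
    the inequalities i < j and k < l follow from those listed. *)
Definition crossing_chain o c : Prop :=
  exists i j k l : 'I_n, [/\ c i < o k, o k < c j, c j < o l & j < k].

(** The order of o j and c i and that of o l and c k are free in a chain; each
    of the four combinations is one of the patterns. *)
Lemma avoids_no_chain o c : separated o c ->
  ~~ contains (mk_matching o c) P2 -> ~~ contains (mk_matching o c) P3 ->
  ~~ contains (mk_matching o c) P4 -> ~~ contains (mk_matching o c) P5 ->
  ~ crossing_chain o c.
Proof.
move=> sep noP2 noP3 noP4 noP5 [i [j [k [l [ltik ltkj ltjl ltjk]]]]].
have [inco incc ltoc neq] := sep.
have /and5P[_ match2 match3 match4 /andP[match5 _]] := patterns_are_matchings.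
have arc m : is_arc (mk_matching o c) (o m) (c m) by apply/mk_matchingP => //; exists m.
have ltij : i < j by rewrite -(incr_ltE incc); apply: ltn_trans ltkj.
have ltkl : k < l by rewrite -(incr_ltE inco); apply: ltn_trans ltjl.
have oij := inco _ _ ltij; have ojk := inco _ _ ltjk; have okl := inco _ _ ltkl.
have cij := incc _ _ ltij; have cjk := incc _ _ ltjk; have ckl := incc _ _ ltkl.
have ltoi := ltoc i; have ltol := ltoc l.
case: (ltngtP (o j) (c i)) => [ji|ij|/ord_inj/eqP]; last by rewrite (negbTE (neq _ _)).
  case: (ltngtP (o l) (c k)) => [lk|kl|/ord_inj/eqP]; last by rewrite (negbTE (neq _ _)).
    case/negP: noP2; apply:
      (@contains_of_seq _ _ _ (o i) [:: o i; o j; c i; o k; c j; o l; c k; c l]) => //=.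
      by rewrite oij ji ltik ltkj ltjl lk ckl.
    by rewrite !arc.
  case/negP: noP5; apply:
      (@contains_of_seq _ _ _ (o i) [:: o i; o j; c i; o k; c j; c k; o l; c l]) => //=.
    by rewrite oij ji ltik ltkj cjk kl ltol.
  by rewrite !arc.
case: (ltngtP (o l) (c k)) => [lk|kl|/ord_inj/eqP]; last by rewrite (negbTE (neq _ _)).
  case/negP: noP4; apply:
      (@contains_of_seq _ _ _ (o i) [:: o i; c i; o j; o k; c j; o l; c k; c l]) => //=.
    by rewrite ltoi ij ojk ltkj ltjl lk ckl.
  by rewrite !arc.
case/negP: noP3; apply:
      (@contains_of_seq _ _ _ (o i) [:: o i; c i; o j; o k; c j; c k; o l; c l]) => //=.
  by rewrite ltoi ij ojk ltkj cjk kl ltol.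
by rewrite !arc.
Qed.

(** In each of the four patterns, the third opener lies between the closers of
    the first two arcs, and the second closer precedes the fourth opener. *)
Lemma no_chain_avoids o c : separated o c -> ~ crossing_chain o c ->
  forall s, s \in [:: [:: (1, 3); (2, 5); (4, 7); (6, 8)];
                    [:: (1, 2); (3, 5); (4, 6); (7, 8)];
                    [:: (1, 2); (3, 5); (4, 7); (6, 8)];
                    [:: (1, 3); (2, 5); (4, 6); (7, 8)]] ->
  ~~ contains (mk_matching o c) (arcs_of 4 s).
Proof.
move=> sep nochain s s_in; have [inco incc ltoc neq] := sep.
have match_s : is_matching (arcs_of 4 s).
  have /and5P[_ ? ? ? /andP[? _]] := patterns_are_matchings.
  by move: s_in; rewrite !inE => /or4P[] /eqP->.
have range : all (fun ab => [&& 0 < ab.1, ab.1 < ab.2 & ab.2 <= 8]) s.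
  by move: s_in; rewrite !inE => /or4P[] /eqP->.
apply/negP=> /contains_arcsP[||g incg arcs] //; apply: nochain.
move: s_in; rewrite !inE => /or4P[] /eqP eq_s; move: arcs; rewrite eq_s => /and5P[]
  /(mk_matchingP _ _ sep)[i gi ci] /(mk_matchingP _ _ sep)[j gj cj]
  /(mk_matchingP _ _ sep)[k gk ck] /(mk_matchingP _ _ sep)[l gl cl] _;
  exists i, j, k, l; rewrite -ci -gk -cj -gl -(incr_ltE inco) -gj -gk /=;
  by split; apply: incg.
Qed.

(** With the first and the last arc as its outer arcs, a chain is produced by
    any j < k for which o k < c j, c 0 < o k and c j < o (n-1). So outside the
    initial openers and the final closers, o k < c j forces k <= j. *)
Lemma chain_free_two_step o c : separated o c -> ~ crossing_chain o c ->
  exists t, forall k j, (o k < c j) = two_step t k j.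
Proof.
move=> sep nochain; have [inco incc ltoc neq] := sep.
have geE k j : ~~ (o k < c j) -> c j < o k.
  by rewrite -leqNgt ltn_neqAle (inj_eq val_inj) eq_sym neq.
case: (boolP [exists k, exists j, c j < o k]) => [|/existsPn noex]; last first.
  exists None => k j; rewrite /two_step; apply/negPn/negP => /geE ltjk.
  by case/negP: (noex k); apply/existsP; exists j.
case/existsP=> k1 /existsP[j1 ltjk1].
have n_gt0 : 0 < n by have := ltn_ord k1; lia.
have n1_lt : n.-1 < n by rewrite prednK.
pose first := Ordinal n_gt0; pose final := Ordinal n1_lt.
have o_le i j : (o i <= o j) = (i <= j) by rewrite leqNgt incr_ltE // -leqNgt.
have c_le i j : (c i <= c j) = (i <= j) by rewrite leqNgt incr_ltE // -leqNgt.
have le_first j : c first <= c j by rewrite c_le.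
have le_final k : o k <= o final by rewrite o_le /=; have := ltn_ord k; lia.
have lt_ff : c first < o final.
  by apply: leq_ltn_trans (le_first j1) _; apply: leq_trans ltjk1 (le_final k1).
have P_first : o first < c first by apply: ltoc.
case: (@arg_maxnP _ first (fun k => o k < c first) (fun k => k : nat) P_first) => p pP maxp.
case: (@arg_maxnP _ first (fun j => c j < o final) (fun k => k : nat) lt_ff) => q qP maxq.
have lt_p : p < n.-1 by rewrite -(incr_ltE inco p final); apply: ltn_trans lt_ff.
have lt_q : q < n.-1 by rewrite -(incr_ltE incc q final); apply: ltn_trans (ltoc final).
exists (Some (Ordinal lt_p, Ordinal lt_q)) => k j; rewrite /two_step /=.
apply/idP/or3P => [ltkj|[lekp|ltqj|lekj]].
- case: (leqP k p) => [|ltpk]; first by constructor 1.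
  case: (leqP j q) => [lejq|]; last by constructor 2.
  case: (leqP k j) => [|ltjk]; first by constructor 3.
  case: nochain; exists first, j, k, final; split=> //.
    by apply: geE; apply: contraL ltpk => /maxp; rewrite -leqNgt.
  by apply: leq_ltn_trans qP; rewrite c_le.
- by apply: leq_trans (le_first j); apply: leq_ltn_trans pP; rewrite o_le.
- apply: leq_ltn_trans (le_final k) _; apply: contraLR ltqj => /geE /maxq.
  by rewrite -leqNgt.
- by apply: leq_trans (ltoc k) _; rewrite c_le.
Qed.

(** In a chain o k > c i gives k > p, and c j < o l gives j <= q, so that
    o k < c j requires k <= j. *)
Lemma two_step_chain_free o c t : separated o c ->
  (forall k j, (o k < c j) = two_step t k j) -> ~ crossing_chain o c.
Proof.
move=> sep rel; have [inco incc ltoc neq] := sep.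
move=> [i [j [k [l [ltik ltkj ltjl ltjk]]]]].
have : ~~ (o k < c i) by rewrite -leqNgt ltnW.
have : ~~ (o l < c j) by rewrite -leqNgt ltnW.
move: ltkj; rewrite !rel /two_step; case: t rel => [[p q]|] //= _.
lia.
Qed.
End Avoiders.

Definition avoider_of n (t : option ('I_n.-1 * 'I_n.-1)) : {set {set 'I_(n.*2)}} :=
  mk_matching (opener_of (two_step t)) (closer_of (two_step t)).

Lemma avoider_of_inj n : injective (@avoider_of n).
Proof.
move=> t t' eq_t.
have stair u := @two_step_staircase n u; have sep u := staircase_separated (stair u).
have [eqo eqc] := mk_matching_inj (sep t) (sep t') eq_t.
apply: two_step_inj => k j.
by rewrite -(staircase_ltE (stair t)) -(staircase_ltE (stair t')) eqo eqc.
Qed.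

(** Stated for variable patterns, because simplification would unfold concrete
    ones. *)
Lemma mem_avoiders m n (Q1 Q2 Q3 Q4 Q5 : {set {set 'I_(m.*2)}})
    (M : {set {set 'I_(n.*2)}}) :
  (M \in stoimenow_avoiders n [:: Q1; Q2; Q3; Q4; Q5]) =
  stoimenow M && [&& ~~ contains M Q1, ~~ contains M Q2, ~~ contains M Q3,
                     ~~ contains M Q4 & ~~ contains M Q5].
Proof. by rewrite inE /= andbT. Qed.

Lemma stoimenow_avoidersE n :
  stoimenow_avoiders n [:: P1; P2; P3; P4; P5] = [set avoider_of t | t in setT].
Proof.
apply/setP=> M; rewrite mem_avoiders; apply/andP/imsetP.
  case=> stoiM /and5P[noP1 noP2 noP3 noP4 noP5].
  have /andP[matchM _] := stoiM.
  have [o [c [sep defM]]] :=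
    nonnesting_present matchM (stoimenow_nonnesting stoiM noP1).
  rewrite defM in noP2 noP3 noP4 noP5 *.
  have [t rel] := chain_free_two_step sep (avoids_no_chain sep noP2 noP3 noP4 noP5).
  have stair := two_step_staircase t; exists t; first exact: in_setT.
  have [|eqo eqc] := separated_ext sep (staircase_separated stair).
    by move=> k j; rewrite rel staircase_ltE.
  by apply: eq_imset => k; rewrite eqo eqc.
case=> t _ ->; have stair := two_step_staircase t.
have sep := staircase_separated stair.
have nochain := two_step_chain_free sep (staircase_ltE stair).
have nn := mk_matching_nonnesting sep.
have avoids := no_chain_avoids sep nochain.
split; first exact: nonnesting_stoimenow (mk_matching_matching sep) nn.
apply/and5P; split; first exact: nonnesting_avoids_P1.
- exact: (avoids [:: (1, 3); (2, 5); (4, 7); (6, 8)]).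
- exact: (avoids [:: (1, 2); (3, 5); (4, 6); (7, 8)]).
- exact: (avoids [:: (1, 2); (3, 5); (4, 7); (6, 8)]).
- exact: (avoids [:: (1, 3); (2, 5); (4, 6); (7, 8)]).
Qed.

(** The predecessor makes the formula right for n = 0 as well, where the only
    parameter is None. *)
Lemma card_stoimenow_avoiders n :
  #|stoimenow_avoiders n [:: P1; P2; P3; P4; P5]| = (n.-1 ^ 2).+1.
Proof.
rewrite stoimenow_avoidersE card_imset; last exact: avoider_of_inj.
by rewrite cardsT card_option card_prod !card_ord mulnn.
Qed.

(** * The generating function *)

Local Open Scope ring_scope.

Lemma fps_mulC (K : fieldType) (a b : fps K) : fps_mul a b =1 fps_mul b a.
Proof.
move=> n; rewrite /fps_mul (reindex_inj rev_ord_inj) /=.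
by apply: eq_bigr => i _; rewrite subSS mulrC subKn // -ltnS.
Qed.

Lemma fps_inv_unique (K : fieldType) (a u : fps K) : a 0%N != 0 ->
  fps_mul u a =1 fps_of_poly 1 -> u =1 fps_inv a.
Proof.
move=> a0 ua1 n; elim/ltn_ind: n => n IHn.
have := fps_mulVf a0 n; rewrite -ua1 /fps_mul !big_ord_recr /= subnn.
under eq_bigr => i _ do rewrite -IHn //.
by move/addrI/(mulIf a0).
Qed.

Lemma fps_mul_cubic (K : fieldType) (p : {poly K}) (u : fps K) n : (size p <= 4)%N ->
  fps_mul (fps_of_poly p) u n.+3 =
  p`_0 * u n.+3 + p`_1 * u n.+2 + p`_2 * u n.+1 + p`_3 * u n.
Proof.
move=> le_p; rewrite /fps_mul /fps_of_poly !big_ord_recl /= big1 => [|i _]; last first.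
  by rewrite nth_default ?mul0r // (leq_trans le_p).
by rewrite /bump /= !subSS !subn0 addr0 !addrA.
Qed.

Lemma one_minusX_cube (K : fieldType) :
  (1 - 'X : {poly K}) ^+ 3 = 1 - 3%:R *: 'X + 3%:R *: 'X^2 - 'X^3.
Proof.
by rewrite !scaler_nat; ring.
Qed.

Lemma triangularS n : 'C(n.+3, 2) = ('C(n.+2, 2) + n.+2)%N.
Proof. by rewrite binS bin1. Qed.

(** Multiplying by the cubic 1 - 3x + 3x^2 - x^3 takes third differences, which
    vanish on the quadratic sequence C(n+2, 2). *)
Lemma fps_inv_cube (K : fieldType) n :
  fps_inv (fps_of_poly ((1 - 'X) ^+ 3)) n = 'C(n.+2, 2)%:R :> K.
Proof.
have coefsE i : ((1 - 'X : {poly K}) ^+ 3)`_i =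
    (i == 0%N)%:R - 3%:R * (i == 1%N)%:R + 3%:R * (i == 2)%:R - (i == 3)%:R.
  by rewrite one_minusX_cube !coefE.
apply/esym/(@fps_inv_unique _ _ (fun n => 'C(n.+2, 2)%:R)).
  by rewrite /fps_of_poly coefsE /= !mulr0 subr0 addr0 subr0 oner_eq0.
move=> m; rewrite fps_mulC /fps_of_poly coef1.
case: m => [|[|[|m]]].
- by rewrite /fps_mul big_ord_recl big_ord0 !coefsE /= subn0 binn; ring.
- rewrite /fps_mul !big_ord_recl big_ord0 !coefsE /= /bump /=.
  by rewrite !(subSS, subn0) !triangularS binn; ring.
- rewrite /fps_mul !big_ord_recl big_ord0 !coefsE /= /bump /=.
  by rewrite !(subSS, subn0) !triangularS binn; ring.
rewrite fps_mul_cubic; last first.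
  by apply/leq_sizeP => j; rewrite coefsE; case: j => [|[|[|[|j]]]] //= _; ring.
by rewrite !coefsE /= !triangularS; ring.
Qed.

Theorem theorem6p1 :
  (fun n : nat => #|stoimenow_avoiders n [:: P1; P2; P3; P4; P5]|%:R : rat)
    =1 fps_div (fps_of_poly (1 - 2%:R *: 'X + 2%:R *: 'X^2 + 'X^3))
               (fps_of_poly ((1 - 'X) ^+ 3)).
Proof.
move=> n; rewrite card_stoimenow_avoiders /fps_div.
have coefsE i : (1 - 2%:R *: 'X + 2%:R *: 'X^2 + 'X^3 : {poly rat})`_i =
    (i == 0%N)%:R - 2%:R * (i == 1%N)%:R + 2%:R * (i == 2)%:R + (i == 3)%:R.
  by rewrite !coefE.
case: n => [|[|[|n]]].
- rewrite /fps_mul big_ord_recl big_ord0 /fps_of_poly coefsE fps_inv_cube /=.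
  by rewrite subn0 binn; ring.
- rewrite /fps_mul !big_ord_recl big_ord0 /fps_of_poly !coefsE !fps_inv_cube.
  by rewrite /= /bump /= !(subSS, subn0) !triangularS binn; ring.
- rewrite /fps_mul !big_ord_recl big_ord0 /fps_of_poly !coefsE !fps_inv_cube.
  by rewrite /= /bump /= !(subSS, subn0) !triangularS binn; ring.
have size4 :
    (size (1 - 2%:R *: 'X + 2%:R *: 'X^2 + 'X^3 : {poly rat})%R <= 4)%N.
  by apply/leq_sizeP => j; rewrite coefsE; case: j => [|[|[|[|j]]]] //= _; ring.
rewrite fps_mul_cubic // !fps_inv_cube !triangularS /fps_of_poly.
(* Everything is now in terms of n and t = C(n+2, 2), and the relation
   2 t = (n+1)(n+2) makes the identity polynomial in n. *)
have := mul_bin_left n.+2 1; rewrite bin1 subn1.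
move: 'C(n.+2, 2) => t /(congr1 (fun m => m%:R : rat)) /=.
by rewrite !natrM !coefsE /= => twice; ring: twice.
Qed.
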